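(* Let $R$ be a commutative Noetherian ring and let $F = \big(0 \to F_b \xrightarrow{\partial_b} F_{b-1} \to \cdots \to F_{a+1} \xrightarrow{\partial_{a+1}} F_a \to 0\big)$ be a bounded complex of free $R$-modules of finite rank. For each $n \in \mathbb{Z}$ set $r_n = \sum_{i \ge n} (-1)^{i-n} \operatorname{rank}_R F_i$. Then $$\dim_R \operatorname{Hom}_R(F,R) = \sup\{\dim(R/I_{r_n}(\partial_n)) + n \mid n \in \mathbb{Z}\}.$$
   Context: Complexes are graded homologically: $\partial_n : F_n \to F_{n-1}$, with $F_n = 0$ for $n \notin [a,b]$. The dual complex $\operatorname{Hom}_R(F,R)$ has $\operatorname{Hom}_R(F_{-n},R)$ in degree $n$ (so it is concentrated in degrees $[-b,-a]$), and its $n$-th differential is $\operatorname{Hom}_R(\partial_{1-n},R)$. Dimension of a complex (Foxby): for an $R$-complex $X$, $\dim_R X = \sup\{\dim(R/\mathfrak{p}) - \inf H(X)_{\mathfrak{p}} \mid \mathfrak{p} \in \operatorname{Spec} R\}$, where $\inf H(X)_{\mathfrak{p}} = \inf\{n \mid H_n(X)_{\mathfrak{p}} \neq 0\}$ and $\dim$ of a ring is Krull dimension. Primes with $H(X)_{\mathfrak p} = 0$ have $\inf H(X)_{\mathfrak p} = \infty$ and contribute $-\infty$. The dimension of the zero ring or zero module is $-\infty$. Suprema are taken in $\mathbb{Z} \cup \{\pm\infty\}$. Ideals of minors: for a map $\varphi$ between free modules of finite rank, $I_s(\varphi)$ is the ideal of $R$ generated by the $s \times s$ minors of a matrix representing $\varphi$.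 Conventions: for $s \le 0$ an $s \times s$ minor of any matrix is $1$, so $I_s(\varphi) = R$. For $s \ge 1$, an $s \times s$ minor of a non-empty matrix is $0$ if $s$ exceeds the number of rows or columns. All minors of the empty ($0 \times 0$) matrix are $1$. A matrix of size $f \times 0$ or $0 \times f$ with $f \ge 1$ is regarded as non-empty, so its $s \times s$ minors with $s\ge 1$ are $0$. In particular $I_{r_n}(\partial_n) = R$ for integers $n$ outside $[a,b]$. *)

(* Defs.v *)
From HB Require Import structures.
From mathcomp Require Import all_boot all_order all_algebra generic_quotient.
From mathcomp Require Import boolp classical_sets functions fsbigop.
From mathcomp Require Import constructive_ereal ring.

Set Implicit Arguments.
Unset Strict Implicit.
Unset Printing Implicit Defensive.
Import Order.TTheory GRing.Theory Num.Theory.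
Local Open Scope classical_set_scope.
Local Open Scope ring_scope.
Local Open Scope quotient_scope.

(* Suprema and infima are taken in the extended integers [\bar int]; by
   [supremums_bar_int] they always exist. *)
Section ExtendedIntegers.
Implicit Types A : set (\bar int).

Lemma supremums_bar_int A : supremums A !=set0.
Proof.
have [Apy|NApy] := pselect (A +oo%E).
  by exists +oo%E; split=> [x _|y]; [exact: leey|apply].
have [[z Az]|ANy] := pselect (exists z : int, A z%:E); last first.
  exists -oo%E; split=> [[z| |] Az|y _] //; last exact: leNye.
  by case: ANy; exists z.
have [[M AM]|Nbd] := pselect (exists M : int, forall z, A z%:E -> z <= M).
- pose P (n : nat) := `[< A (M - n%:Z)%:E >].
  have toP y : A y%:E -> P `|M - y|%N.
    move=> Ay; apply/asboolP.
    by rewrite gez0_abs ?subr_ge0 ?AM// opprB addrC subrK.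
  have exP : exists n, P n by exists `|M - z|%N; exact: toP.
  case: (ex_minnP exP) => n /asboolP Pn minn.
  exists (M - n%:Z)%:E; split=> [[y| |] Ay|y ubA]; last exact: ubA.
  + have := minn _ (toP _ Ay); rewrite -lez_nat gez0_abs ?subr_ge0; last exact: AM.
    by rewrite lee_fin lerBrDr -lerBrDl.
  + by case: NApy.
  + exact: leNye.
- exists +oo%E; split=> [x _|[y| |] ubA]; first exact: leey.
  + by case: Nbd; exists y => w Aw; have := ubA _ Aw; rewrite lee_fin.
  + by [].
  + by have := ubA _ Az.
Qed.

Definition esup A : \bar int := supremum -oo%E A.
Definition einf A : \bar int := (- esup [set - x | x in A])%E.

End ExtendedIntegers.

Section Ideals.
Variable R : comPzRingType.

Definition ideal_axiom (I : set R) : Prop :=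
  I 0 /\ forall a u v, I u -> I v -> I (a * u + v).

Record ideal := Ideal { ideal_set :> set R; idealP : ideal_axiom ideal_set }.

Lemma ideal_gen_subproof (S : set R) : ideal_axiom (smallest ideal_axiom S).
Proof.
split=> [I [[]] //|a u v Iu Iv I IS].
by case: (IS) => -[_ I_lin] _; apply: I_lin; [apply: Iu|apply: Iv].
Qed.

Definition ideal_gen (S : set R) : ideal := Ideal (ideal_gen_subproof S).

Definition noetherian : Prop :=
  forall I : ideal, exists s : seq R, I = ideal_gen [set` s].

Record Spec := PrimeIdeal {
  prime_ideal :> ideal;
  prime_proper : ~ ideal_set prime_ideal 1;
  prime_mul : forall u v, ideal_set prime_ideal (u * v) ->
    ideal_set prime_ideal u \/ ideal_set prime_ideal v }.

(* In particular the zero ring has dimension -oo. *)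
Definition krull_dim : \bar int :=
  esup [set l%:Z%:E | l in [set l : nat | exists p : nat -> Spec,
    forall i, (i < l)%N -> (p i : set R) `<` p i.+1]].

Definition ideal_pred (I : ideal) : {pred R} := fun x => x \in (I : set R).

End Ideals.

Section QuotientRing.
Variables (R : comPzRingType) (I : ideal R).

Fact ideal_pred_zmod : zmod_closed (ideal_pred I).
Proof.
have [I0 Ilin] := idealP I; split; first exact/mem_set.
move=> x y /set_mem Ix /set_mem Iy; apply/mem_set.
by rewrite addrC -mulN1r; exact: Ilin.
Qed.

HB.instance Definition _ := GRing.isZmodClosed.Build R (ideal_pred I)
  ideal_pred_zmod.

(* [ring_quotient] equips [{ideal_quot I}] with a multiplication only when [R] is
   nonzero and [I] is proper; here [I = R] is allowed and gives the zero ring. *)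
Definition quot_ring := {ideal_quot (ideal_pred I)}.

HB.instance Definition _ := GRing.Zmodule.on quot_ring.

Let pi (x : R) : quot_ring := \pi_{ideal_quot (ideal_pred I)} x.
Let rep (x : quot_ring) : R := repr x.

Let piP x y : pi x = pi y <-> (I : set R) (x - y).
Proof.
split=> [/eqP|Ixy]; first by rewrite /pi -Quotient.idealrBE => /set_mem.
by apply/eqP; rewrite /pi -Quotient.idealrBE; exact/mem_set.
Qed.

Let repK x : pi (rep x) = x. Proof. exact: reprK. Qed.

Let piD x y : pi (x + y) = pi x + pi y. Proof. exact: raddfD. Qed.

Definition quot_ring_one : quot_ring := pi 1.
Definition quot_ring_mul (x y : quot_ring) : quot_ring := pi (rep x * rep y).

Let piM x y : quot_ring_mul (pi x) (pi y) = pi (x * y).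
Proof.
have [I0 Ilin] := idealP I.
have Irep z : (I : set R) (rep (pi z) - z) by apply/piP; rewrite repK.
apply/piP.
have -> : rep (pi x) * rep (pi y) - x * y =
    rep (pi y) * (rep (pi x) - x) + (x * (rep (pi y) - y) + 0) by ring.
by apply: (Ilin) => //; exact: Ilin.
Qed.

Fact quot_ring_mulA : associative quot_ring_mul.
Proof.
by move=> x y z; rewrite -(repK x) -(repK y) -(repK z) !piM mulrA.
Qed.

Fact quot_ring_mulC : commutative quot_ring_mul.
Proof. by move=> x y; rewrite -(repK x) -(repK y) !piM mulrC. Qed.

Fact quot_ring_mul1 : left_id quot_ring_one quot_ring_mul.
Proof. by move=> x; rewrite -(repK x) piM mul1r. Qed.

Fact quot_ring_mulD : left_distributive quot_ring_mul +%R.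
Proof.
move=> x y z; rewrite -(repK x) -(repK y) -(repK z).
by rewrite -piD !piM -piD mulrDl.
Qed.

HB.instance Definition _ := GRing.Zmodule_isComPzRing.Build quot_ring
  quot_ring_mulA quot_ring_mulC quot_ring_mul1 quot_ring_mulD.

End QuotientRing.

Section QuotientModule.
Variables (R : pzRingType) (M : lmodType R) (N : submodClosed M).

Definition submod_pred : {pred M} := N.

Fact submod_pred_zmod : zmod_closed submod_pred.
Proof.
split=> [|x y Nx Ny]; first exact: rpred0.
by rewrite -scaleN1r; exact: (@rpredD _ N _ _ Nx (@rpredZ _ _ N _ _ Ny)).
Qed.

HB.instance Definition _ := GRing.isZmodClosed.Build M submod_pred
  submod_pred_zmod.

Definition quot_module := {ideal_quot submod_pred}.

HB.instance Definition _ := GRing.Zmodule.on quot_module.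

Let pi (x : M) : quot_module := \pi_{ideal_quot submod_pred} x.
Let rep (x : quot_module) : M := repr x.
Let repK x : pi (rep x) = x. Proof. exact: reprK. Qed.
Let piD x y : pi (x + y) = pi x + pi y. Proof. exact: raddfD. Qed.

Definition quot_module_scale (a : R) (x : quot_module) : quot_module :=
  pi (a *: rep x).

Let piZ a x : quot_module_scale a (pi x) = pi (a *: x).
Proof.
apply/eqP; rewrite /pi -Quotient.idealrBE -scalerBr.
apply: (@rpredZ R M N); change (rep (pi x) - x \in submod_pred).
by rewrite Quotient.idealrBE; apply/eqP/repK.
Qed.

Fact quot_module_scaleA a b x :
  quot_module_scale a (quot_module_scale b x) = quot_module_scale (a * b) x.
Proof. by rewrite -(repK x) !piZ scalerA. Qed.

Fact quot_module_scale1 : left_id 1 quot_module_scale.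
Proof. by move=> x; rewrite -(repK x) piZ scale1r. Qed.

Fact quot_module_scaleDr : right_distributive quot_module_scale +%R.
Proof.
by move=> a x y; rewrite -(repK x) -(repK y) -piD !piZ -piD scalerDr.
Qed.

Fact quot_module_scaleDl x : {morph quot_module_scale^~ x : a b / a + b}.
Proof. by move=> a b; rewrite -(repK x) !piZ -piD scalerDl. Qed.

HB.instance Definition _ := GRing.Zmodule_isLmodule.Build R quot_module
  quot_module_scaleA quot_module_scale1 quot_module_scaleDr
  quot_module_scaleDl.

End QuotientModule.

Section Localization.
Variables (R : comPzRingType) (M : lmodType R) (p : Spec R).

Definition denom : Type := {s : R | s \notin (p : set R)}.
HB.instance Definition _ := SubChoice.on denom.
Definition fraction : Type := (M * denom)%type.
HB.instance Definition _ := Choice.on fraction.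

(* m / s = m' / s' iff t (s' m - s m') = 0 for some t outside p *)
Definition frac_equiv : rel fraction := fun x y =>
  `[< exists t : denom,
      val t *: (val y.2 *: x.1 - val x.2 *: y.1) = 0 >].

Fact denom1_subproof : 1 \notin (p : set R).
Proof. by apply/negP => /set_mem; exact: prime_proper. Qed.

Fact denomM_subproof (s t : denom) : val s * val t \notin (p : set R).
Proof.
apply/negP => /set_mem /prime_mul [] /mem_set; apply/negP;
  [exact: (valP s)|exact: (valP t)].
Qed.

Definition denom1 : denom := Sub 1 denom1_subproof.
Definition denomM (s t : denom) : denom :=
  Sub (val s * val t) (denomM_subproof s t).

Fact frac_equiv_is_equiv : equiv_class_of frac_equiv.
Proof.
split=> [x|x y|y x z].
- by apply/asboolP; exists denom1; rewrite subrr scaler0.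
- by apply/asboolP/asboolP => -[t tE]; exists t; apply: oppr_inj;
    rewrite -scalerN opprB tE oppr0.
move=> /asboolP[t tE] /asboolP[u uE]; apply/asboolP.
exists (denomM (denomM t u) y.2) => /=; move: tE uE.
case: x y z => [m s] [m' s'] [m'' s''] /=.
move: (val t) (val u) (val s) (val s') (val s'') => {}t {}u {}s {}s' {}s''.
rewrite !scalerBr !scalerA => /subr0_eq tE /subr0_eq uE.
apply/eqP; rewrite subr_eq0; apply/eqP.
have -> : t * u * s' * s'' = (u * s'') * (t * s') by ring.
rewrite -[LHS]scalerA tE scalerA.
have -> : u * s'' * (t * s) = (t * s) * (u * s'') by ring.
by rewrite -[LHS]scalerA uE scalerA; congr (_ *: _); ring.
Qed.

Canonical frac_equiv_equiv := EquivRelPack frac_equiv_is_equiv.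
Canonical frac_equiv_encModRel := defaultEncModRel frac_equiv.

Definition localization := {eq_quot frac_equiv}.

HB.instance Definition _ := Choice.on localization.

Let pi (x : fraction) : localization := \pi_{eq_quot frac_equiv} x.
Let rep (x : localization) : fraction := repr x.
Let repK x : pi (rep x) = x. Proof. exact: reprK. Qed.
Let piP x y : pi x = pi y <-> frac_equiv x y.
Proof. by split=> [/eqmodP|?]; last exact/eqmodP. Qed.

Definition frac_add (x y : fraction) : fraction :=
  (val y.2 *: x.1 + val x.2 *: y.1, denomM x.2 y.2).
Definition frac_opp (x : fraction) : fraction := (- x.1, x.2).

Definition loc_zero : localization := pi (0, denom1).
Definition loc_add (x y : localization) : localization :=
  pi (frac_add (rep x) (rep y)).
Definition loc_opp (x : localization) : localization := pi (frac_opp (rep x)).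

Fact frac_addC x y : frac_add x y = frac_add y x.
Proof. by congr pair; [rewrite addrC|apply: val_inj; rewrite /= mulrC]. Qed.

Let pi_addl x x' y : pi x = pi x' -> pi (frac_add x y) = pi (frac_add x' y).
Proof.
move=> /piP/asboolP[t tE]; apply/piP/asboolP; exists t; move: tE => /=.
case: x x' y => [m s] [m' s'] [n v] /=.
move: (val t) (val s) (val s') (val v) => {}t {}s {}s' {}v.
rewrite !scalerBr !scalerDr !scalerA => /subr0_eq tE.
have -> : t * (s' * v * v) = v * v * (t * s') by ring.
have -> : t * (s * v * v) = v * v * (t * s) by ring.
rewrite -!(scalerA (v * v)) tE; apply/eqP; rewrite subr_eq0; apply/eqP.
by congr (_ + _ *: _); ring.
Qed.

Let piD x y : loc_add (pi x) (pi y) = pi (frac_add x y).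
Proof.
rewrite /loc_add (pi_addl _ (repK _)) frac_addC (pi_addl _ (repK _)).
by rewrite frac_addC.
Qed.

Let piN x : loc_opp (pi x) = pi (frac_opp x).
Proof.
apply/piP/asboolP; have /piP/asboolP[t tE] := repK (pi x).
by exists t; rewrite /= !scalerN -opprD scalerN tE oppr0.
Qed.

Fact loc_addA : associative loc_add.
Proof.
move=> x y z; rewrite -(repK x) -(repK y) -(repK z) !piD; congr pi.
case: (rep x) (rep y) (rep z) => [m s] [n t] [l u] /=.
congr pair; last by apply: val_inj; rewrite /= mulrA.
rewrite /= !scalerDr !scalerA addrA.
by congr (_ *: _ + _ *: _ + _); ring.
Qed.

Fact loc_addC : commutative loc_add.
Proof. by move=> x y; rewrite -(repK x) -(repK y) !piD frac_addC. Qed.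

Fact loc_add0 : left_id loc_zero loc_add.
Proof.
move=> x; rewrite -(repK x) piD; congr pi; case: (rep x) => m s.
congr pair; first by rewrite /= scaler0 add0r scale1r.
by apply: val_inj; rewrite /= mul1r.
Qed.

Fact loc_addN : left_inverse loc_zero loc_opp loc_add.
Proof.
move=> x; rewrite -(repK x) piN piD; apply/piP/asboolP; exists denom1.
by rewrite /= scalerN addNr !scaler0 subrr scaler0.
Qed.

HB.instance Definition _ := GRing.isZmodule.Build localization
  loc_addA loc_addC loc_add0 loc_addN.

End Localization.

Section HomModule.
Variables (R : comPzRingType) (U V : lmodType R).

Definition linear_fun : {pred U -> V} := fun f => `[< linear f >].

Fact linear_fun_submod : submod_closed linear_fun.
Proof.
split=> [|c f g /asboolP flin /asboolP glin]; apply/asboolP => a x y.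
  by rewrite scaler0 addr0.
rewrite /= !fctE flin glin !scalerDr !scalerA (mulrC c) addrACA.
by [].
Qed.

HB.instance Definition _ := GRing.isSubmodClosed.Build R (U -> V) linear_fun
  linear_fun_submod.

Record hom_module := Hom { hom_fun :> U -> V; homP : hom_fun \in linear_fun }.

HB.instance Definition _ := [isSub for hom_fun].
HB.instance Definition _ := [Choice of hom_module by <:].
HB.instance Definition _ := [SubChoice_isSubLmodule of hom_module by <:].

HB.instance Definition _ (h : hom_module) :=
  GRing.isLinear.Build R U V _ (hom_fun h) (asboolW (homP h)).

End HomModule.

(* Precomposition with [g], i.e. Hom(g, V). *)
Section HomFunctor.
Variables (R : comPzRingType) (U U' V : lmodType R) (g : {linear U -> U'}).

Fact hom_pre_subproof (h : hom_module U' V) :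
  (h : U' -> V) \o g \in @linear_fun R U V.
Proof.
by apply/asboolP => a x y; rewrite /= !linearP.
Qed.

Definition hom_pre (h : hom_module U' V) : hom_module U V :=
  Hom (hom_pre_subproof h).

Fact hom_pre_linear : linear hom_pre.
Proof. by move=> a h k; apply: val_inj. Qed.

HB.instance Definition _ :=
  GRing.isLinear.Build R (hom_module U' V) (hom_module U V) _ hom_pre
    hom_pre_linear.

End HomFunctor.

(* To avoid transport along equalities of integers, a differential [diff m n]
   is given for all degrees [m] and [n], and required to vanish unless
   [m = n + 1]; the n-th differential is [diff n (n - 1)]. *)
Record complex (R : comPzRingType) := Complex {
  obj :> int -> lmodType R;
  diff : forall m n : int, {linear obj m -> obj n};
  diff_shape : forall m n, m != n + 1 -> diff m n =1 \0;
  diff_diff : forall l m n, diff m n \o diff l m =1 \0 }.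

Arguments diff {R} c m n.

Section Dual.
Variables (R : comPzRingType) (F : complex R).

Definition dual_obj (n : int) : lmodType R := hom_module (F (- n)) R^o.

Definition dual_diff (m n : int) : {linear dual_obj m -> dual_obj n} :=
  hom_pre (V := R^o) (diff F (- n) (- m)).

Fact dual_diff_shape m n : m != n + 1 -> dual_diff m n =1 \0.
Proof.
move=> mn h; apply: val_inj; apply/funext => x /=.
rewrite diff_shape ?linear0//; apply: contraNneq mn => nm.
by apply/eqP/oppr_inj; rewrite opprD nm addrK.
Qed.

Fact dual_diff_diff l m n : dual_diff m n \o dual_diff l m =1 \0.
Proof.
move=> h; apply: val_inj; apply/funext => x /=.
by have /= -> := @diff_diff _ F (- n) (- m) (- l) x; rewrite linear0.
Qed.

Definition dual : complex R := Complex dual_diff_shape dual_diff_diff.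

End Dual.

Section Homology.
Variables (R : comPzRingType) (X : complex R) (n : int).

Definition cycle_pred : {pred X n} := fun x => diff X n (n - 1) x == 0.

Fact cycle_pred_submod : submod_closed cycle_pred.
Proof.
split=> [|a x y]; rewrite !unfold_in ?linear0// => /eqP x0 /eqP y0.
by rewrite linearP x0 y0 scaler0 addr0.
Qed.

HB.instance Definition _ := GRing.isSubmodClosed.Build R (X n) cycle_pred
  cycle_pred_submod.

Record cycles := Cycle { cycle_val :> X n; cycleP : cycle_val \in cycle_pred }.

HB.instance Definition _ := [isSub for cycle_val].
HB.instance Definition _ := [Choice of cycles by <:].
HB.instance Definition _ := [SubChoice_isSubLmodule of cycles by <:].

Definition boundary_pred : {pred cycles} := fun z =>
  `[< exists y, diff X (n + 1) n y = val z >].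

Fact boundary_pred_submod : submod_closed boundary_pred.
Proof.
split=> [|a x y /asboolP[u uE] /asboolP[v vE]]; apply/asboolP.
  by exists 0; rewrite linear0.
by exists (a *: u + v); rewrite linearP uE vE.
Qed.

HB.instance Definition _ := GRing.isSubmodClosed.Build R cycles boundary_pred
  boundary_pred_submod.

Definition homology : lmodType R := quot_module boundary_pred.

End Homology.

Section Dimension.
Variables (R : comPzRingType) (X : complex R).

Definition inf_homology (p : Spec R) : \bar int :=
  einf [set n%:E | n in
    [set n | exists x : localization (homology X n) p, x != 0]].

(* In [\bar int], [x - +oo = -oo] for all [x], so primes outside the support
   of H(X) contribute -oo. *)
Definition dim_complex : \bar int :=
  esup [set (krull_dim (quot_ring p) - inf_homology p)%E | p in [set: Spec R]].

End Dimension.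

Definition is_basis (R : pzRingType) (M : lmodType R) (r : nat)
    (e : 'I_r -> M) : Prop :=
  forall x : M, exists! c : 'I_r -> R, x = \sum_i c i *: e i.

(* [A] represents [phi] acting on column vectors of coordinates. *)
Definition represents (R : pzRingType) (M N : lmodType R) (r s : nat)
    (e : 'I_r -> M) (e' : 'I_s -> N) (phi : M -> N) (A : 'M[R]_(s, r)) : Prop :=
  forall j, phi (e j) = \sum_i A i j *: e' i.

Definition alternating_rank (f : int -> nat) (n : int) : int :=
  \sum_(i \in [set i : int | n <= i]) (-1) ^+ `|i - n|%N * (f i)%:Z.

Definition increasing (m k : nat) : set ('I_m -> 'I_k) :=
  [set g : 'I_m -> 'I_k | {homo g : i j / (i < j)%O}].

(* All minors of size [s <= 0] are 1, as are those of the 0 x 0 matrix.  If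
   [s >= 1] exceeds the number of rows or columns of a non-empty matrix, then
   there are no submatrices to choose and the ideal is 0. *)
Definition minors (R : comPzRingType) (k l : nat) (A : 'M[R]_(k, l)) (s : int) :
    set R :=
  if (s <= 0) || ((k == 0%N) && (l == 0%N)) then [set 1]
  else [set \det (mxsub g h A) |
    g in @increasing `|s|%N k & h in @increasing `|s|%N l].

Definition minor_ideal (R : comPzRingType) (k l : nat) (A : 'M[R]_(k, l))
    (s : int) : ideal R :=
  ideal_gen (minors A s).

(* Main.v *)
(** Fix a prime p with residue field k(p), and let R^(f_n) denote row vectors,
    on which Hom(d_n, R) acts by right multiplication with the matrix of d_n.
    A bounded-above cochain complex of finite free modules has vanishing
    cohomology at p in all degrees n >= m iff it is split exact there, iff d_n
    has rank r_n over k(p) for all n >= m, iff I_(r_n)(d_n) is not contained in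
    p for all n >= m.  Hence the largest n with H^n(Hom(F, R))_p <> 0 is also the
    largest n with I_(r_n)(d_n) contained in p.  Since dim R/I is the supremum of
    dim R/p over the primes p containing I, both sides of the formula are the
    supremum of dim R/p + n over the pairs (p, n) with I_(r_n)(d_n) in p. *)

From HB Require Import structures.
Require Import Defs.
From mathcomp Require Import all_boot all_order all_algebra generic_quotient.
From mathcomp Require Import boolp classical_sets functions fsbigop.
From mathcomp Require Import constructive_ereal.
From mathcomp Require Import cardinality fraction zify.

Set Implicit Arguments.
Unset Strict Implicit.
Unset Printing Implicit Defensive.
Import Order.TTheory GRing.Theory Num.Theory.
Local Open Scope classical_set_scope.
Local Open Scope ring_scope.
Local Open Scope quotient_scope.

(** * Quotient rings and residue fields *)

Section QuotientMap.
Variables (R : comPzRingType) (I : ideal R).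

Lemma idealD x y : (I : set R) x -> (I : set R) y -> (I : set R) (x + y).
Proof. by have [_ Ilin] := idealP I; rewrite -{2}[x]mul1r; exact: Ilin. Qed.

Lemma idealM a x : (I : set R) x -> (I : set R) (a * x).
Proof. by have [I0 Ilin] := idealP I; rewrite -[a * x]addr0 => Ix; exact: Ilin. Qed.

Lemma idealN x : (I : set R) x -> (I : set R) (- x).
Proof. by rewrite -mulN1r; exact: idealM. Qed.

Definition quot_map (x : R) : quot_ring I := \pi_{ideal_quot (ideal_pred I)} x.

Lemma quot_mapP x y : quot_map x = quot_map y <-> (I : set R) (x - y).
Proof.
split=> [/eqP|Ixy]; first by rewrite /quot_map -Quotient.idealrBE => /set_mem.
by apply/eqP; rewrite /quot_map -Quotient.idealrBE; exact/mem_set.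
Qed.

Lemma quot_map_surj (x : quot_ring I) : exists y, quot_map y = x.
Proof. by exists (repr x); exact: reprK. Qed.

Lemma quot_map_zmod : zmod_morphism quot_map.
Proof. by move=> x y; rewrite /quot_map raddfB. Qed.

Lemma quot_map_monoid : monoid_morphism quot_map.
Proof.
split=> // x y; apply/quot_mapP.
have Irep z : (I : set R) (repr (quot_map z) - z) by apply/quot_mapP/reprK.
rewrite -opprB; apply: idealN.
rewrite -[repr _ * repr _](subrK (repr (quot_map x) * y)) -mulrBr -addrA -mulrBl.
by apply: idealD; [|rewrite mulrC]; apply: idealM.
Qed.

HB.instance Definition _ :=
  GRing.isZmodMorphism.Build R (quot_ring I) quot_map quot_map_zmod.
HB.instance Definition _ :=
  GRing.isMonoidMorphism.Build R (quot_ring I) quot_map quot_map_monoid.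

Lemma quot_map_eq0 x : quot_map x = 0 <-> (I : set R) x.
Proof. by rewrite -(raddf0 quot_map) quot_mapP subr0. Qed.

End QuotientMap.

Section ResidueField.
Variables (R : comPzRingType) (p : Spec R).

(** A copy of [quot_ring p] that carries the structures depending on [p] being prime: nonzero ring,
    integral domain. *)
Definition residue_dom : Type := quot_ring p.
HB.instance Definition _ := GRing.ComPzRing.on residue_dom.

Fact residue_dom_neq0 : (1 : residue_dom) != 0.
Proof. by apply/eqP => /(quot_map_eq0 p 1); exact: prime_proper. Qed.

HB.instance Definition _ :=
  GRing.PzSemiRing_isNonZero.Build residue_dom residue_dom_neq0.

(** The integral domain interface asks for an inverse: it is chosen classically, and non-units are
    fixed. *)
Definition residue_unit : {pred residue_dom} :=
  fun x => `[< exists y, y * x = 1 >].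
Definition residue_inv (x : residue_dom) : residue_dom :=
  if pselect (exists y, y * x = 1) is left h then projT1 (cid h) else x.

Fact residue_mulVx : {in residue_unit, left_inverse 1 residue_inv *%R}.
Proof.
move=> x /asboolP hx; rewrite /residue_inv; case: pselect => // h.
by case: (cid h).
Qed.

Fact residue_unitPl : forall x y, y * x = 1 -> residue_unit x.
Proof. by move=> x y yx; apply/asboolP; exists y. Qed.

Fact residue_inv_out : {in [predC residue_unit], residue_inv =1 id}.
Proof.
move=> x /negP hx; rewrite /residue_inv; case: pselect => // h.
by case: hx; apply/asboolP.
Qed.

HB.instance Definition _ := GRing.ComNzRing_hasMulInverse.Build residue_dom
  residue_mulVx residue_unitPl residue_inv_out.

Fact residue_dom_integral : GRing.integral_domain_axiom residue_dom.
Proof.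
move=> x y; have [u <-] := quot_map_surj x; have [v <-] := quot_map_surj y.
rewrite -[_ * _]/(quot_map p u * quot_map p v) -rmorphM => /quot_map_eq0.
by move=> /prime_mul[] puv; apply/orP; [left|right]; apply/eqP/quot_map_eq0.
Qed.

HB.instance Definition _ :=
  GRing.ComUnitRing_isIntegral.Build residue_dom residue_dom_integral.

Definition residue_field : fieldType := {fraction residue_dom}.
Definition residue_map : R -> residue_field :=
  @FracField.tofrac residue_dom \o (quot_map p : R -> residue_dom).

Fact residue_map_zmod : zmod_morphism residue_map.
Proof. by move=> x y; rewrite /residue_map /= raddfB -tofracB. Qed.

Fact residue_map_monoid : monoid_morphism residue_map.
Proof.
split; first by rewrite /residue_map /= rmorph1 -tofrac1.
by move=> x y; rewrite /residue_map /= rmorphM -tofracM.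
Qed.

HB.instance Definition _ :=
  GRing.isZmodMorphism.Build R residue_field residue_map residue_map_zmod.
HB.instance Definition _ :=
  GRing.isMonoidMorphism.Build R residue_field residue_map residue_map_monoid.

Lemma residue_map_eq0 x : residue_map x == 0 <-> (p : set R) x.
Proof. by rewrite /residue_map /= tofrac_eq0 -quot_map_eq0; split=> /eqP. Qed.

End ResidueField.

(** * Minors, rank and split exactness at a prime *)

Section Minors.
Variable K : fieldType.

Lemma row_free_rowsub k l s (f : 'I_s -> 'I_k) (M : 'M[K]_(k, l)) :
  injective f -> row_free M -> row_free (rowsub f M).
Proof.
move=> f_inj freeM; apply/row_freeP; have /row_freeP[N MN] := freeM.
exists (N *m colsub f 1%:M); rewrite mulmxA mul_rowsub_mx MN mulmx_colsub mulmx1.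
by apply/matrixP => i j; rewrite !mxE (inj_eq f_inj).
Qed.

(** [maxrankfun] selects independent rows in no prescribed order. Listing the set [S] of selected
    rows increasingly only permutes them, so the rank is unchanged. *)
Lemma row_free_increasing k l s (M : 'M[K]_(k, l)) : (s <= \rank M)%N ->
  exists2 g : 'I_s -> 'I_k, increasing g & row_free (rowsub g M).
Proof.
move=> sM; pose f := maxrankfun M \o widen_ord sM.
have f_inj : injective f.
  by move=> i j /maxrankfun_inj /(congr1 val) /= /val_inj.
have fM : row_free (rowsub f M).
  rewrite rowsub_comp; apply: row_free_rowsub (maxrowsub_free M) => i j.
  by move=> /(congr1 val) /= /val_inj.
pose S := [set f i | i : 'I_s]%SET.
have cS : #|S| = s by rewrite card_imset// card_ord.
pose g i : 'I_k := Order.enum_val (cast_ord (esym cS) i).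
exists g.
  by move=> i j; rewrite !ltNge Order.le_enum_val //; exact: le_total.
have fS i : f i \in S by apply: imset_f.
pose h i : 'I_s := cast_ord cS (Order.enum_rank_in (fS i) (f i)).
have fg : f =1 g \o h.
  by move=> i; rewrite /= /g /h cast_ordK Order.enum_rankK_in.
have h_inj : injective h by move=> i j hij; apply: f_inj; rewrite !fg /= hij.
by rewrite -row_leq_rank -(eqmx_rowsub h h_inj (leqnn _) fg) row_leq_rank.
Qed.

(** Independent rows are chosen first, then, after transposing, independent columns among them.
    Conversely, a submatrix has at most the rank of [M]. *)
Lemma leq_rank_minorP k l s (M : 'M[K]_(k, l)) : (s <= \rank M)%N <->
  exists g h, [/\ @increasing s k g, @increasing s l h & \det (mxsub g h M) != 0].
Proof.
split=> [/row_free_increasing[g g_incr gM]|[g [h [_ _]]]].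
  have : (s <= \rank (rowsub g M)^T)%N by rewrite mxrank_tr row_leq_rank.
  move=> /row_free_increasing[h h_incr]; rewrite row_free_unit unitmxE unitfE.
  by rewrite -trmx_mxsub det_tr -mxsubcr; exists g, h.
rewrite -unitfE -unitmxE -row_free_unit -row_leq_rank => /leq_trans; apply.
rewrite mxsubrc; apply: leq_trans (mxrankS (rowsub_sub g _)) _.
by rewrite -mxrank_tr trmx_mxsub -(mxrank_tr M) mxrankS ?rowsub_sub.
Qed.

End Minors.

Section LocalSplitting.
Variables (R : comPzRingType) (K : fieldType) (phi : {rmorphism R -> K}).

(** [U] selects the rows of a minor [d], and [V] its columns followed by the adjugate. The identity
    holds over [R] itself: tracking [d] replaces localizing. *)
Lemma rank_factor k l s (M : 'M[R]_(k, l)) : (s <= \rank (map_mx phi M))%N ->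
  exists U V d, phi d != 0 /\ U *m M *m V = d%:M :> 'M_s.
Proof.
move=> /leq_rank_minorP[g [h [_ _]]]; rewrite -map_mxsub det_map_mx => dM.
exists (rowsub g 1%:M), (colsub h 1%:M *m \adj (mxsub g h M)).
exists (\det (mxsub g h M)).
split=> //; rewrite mulmxA -mulmxA mulmxA -rowsubE mulmx_colsub mulmx1.
by rewrite -mxsubcr mul_mx_adj.
Qed.

(* For P = [V, B V'], the product [U C; U'] P is block triangular with diagonal
   blocks c and b, so det P is invertible at p; and (c x - x V U C) P = 0 as
   soon as x B = 0. *)
Lemma exact_splitting k n l s r (C : 'M[R]_(k, n)) (B : 'M_(n, l)) :
    n = (s + r)%N -> C *m B = 0 ->
    (s <= \rank (map_mx phi C))%N -> (r <= \rank (map_mx phi B))%N ->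
  exists (U : 'M_(s, k)) (V : 'M_(n, s)) d, phi d != 0 /\
    forall m (x : 'M_(m, n)), x *m B = 0 -> d *: x = x *m (V *m U) *m C.
Proof.
move=> n_sr; subst n => CB /rank_factor[U [V [c [c0 UCV]]]].
move=> /rank_factor[U' [V' [b [b0 UBV]]]].
pose P := row_mx V (B *m V'); pose Q := col_mx (U *m C) U'.
have QP : Q *m P = block_mx c%:M 0 (U' *m V) b%:M.
  by rewrite mul_col_row UCV (mulmxA U') UBV mulmxA -(mulmxA U) CB mulmx0 mul0mx.
have P0 : phi (\det P) != 0.
  have : phi (\det (Q *m P)) != 0.
    by rewrite QP det_lblock !det_scalar rmorphM !rmorphXn mulf_neq0// expf_neq0.
  by rewrite det_mulmx rmorphM mulf_eq0 negb_or => /andP[].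
(* Cancelling [P] through its adjugate costs a factor [\det P], which enters both [V] and the
   multiplier. *)
exists U, (\det P *: V), (\det P * c); split; first by rewrite rmorphM mulf_neq0.
move=> m x xB.
have xP : (c *: x - x *m V *m U *m C) *m P = 0.
  rewrite mul_mx_row !mulmxBl -!scalemxAl (mulmxA x B) xB mul0mx scaler0.
  rewrite -!mulmxA (mulmxA C B) CB mul0mx !mulmx0 subrr (mulmxA U) UCV.
  by rewrite mul_mx_scalar -scalemxAr subrr row_mx0.
have : (c *: x - x *m V *m U *m C) *m P *m \adj P = 0 by rewrite xP mul0mx.
rewrite -(mulmxA _ P) mul_mx_adj mul_mx_scalar scalerBr scalerA => /subr0_eq ->.
by rewrite -!scalemxAl -scalemxAr -!scalemxAl mulmxA.
Qed.

(* The rows of d - B V U are killed by B, hence up to a unit at p they lie in the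
   row space of C; and d - B V U has rank at least n - r over the residue field. *)
Lemma exact_rank k n l r (C : 'M[R]_(k, n)) (B : 'M_(n, l))
    (U : 'M_(r, n)) (V : 'M_(l, r)) d :
    phi d != 0 -> d *: B = B *m (V *m U) *m B ->
    (forall x : 'rV_n, x *m B = 0 ->
       exists t, phi t != 0 /\ exists y, t *: x = y *m C) ->
  (n - r <= \rank (map_mx phi C))%N.
Proof.
move=> d0 BVU ex; pose E := d%:M - B *m (V *m U).
have EB : E *m B = 0 by rewrite mulmxBl mul_scalar_mx BVU subrr.
have EC : (map_mx phi E <= map_mx phi C)%MS.
  apply/row_subP => i; have [|t [t0 [y]]] := ex (row i E).
    by rewrite -row_mul EB row0.
  move=> /(congr1 (map_mx phi)); rewrite map_mxZ map_mxM map_row => tE.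
  by rewrite -(eqmx_scale _ t0) tE submxMl.
have rkn : \rank (map_mx phi (E + B *m (V *m U))) = n.
  by rewrite subrK map_scalar_mx -scalemx1 mxrank_scale_nz ?mxrank1.
rewrite -{1}rkn leq_subLR map_mxD addnC; apply: leq_trans (mxrank_add _ _) _.
rewrite leq_add ?mxrankS// mulmxA map_mxM.
exact: leq_trans (mxrankM_maxr _ _) (rank_leq_row _).
Qed.

End LocalSplitting.

(** The complex vanishes above [b], so exactness and ranks are controlled from the top degree
    downwards. *)
Lemma int_down_ind (b : int) (P : int -> Prop) : (forall n, b < n -> P n) ->
  (forall n, (forall k, n < k -> P k) -> P n) -> forall n, P n.
Proof.
move=> Pb Pdown n; have [N] : exists N : nat, b < n + N%:Z.
  by exists `|b - n|.+1; lia.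
elim: N n => [|N IHN] n; first by rewrite addr0; exact: Pb.
move=> bn; apply: Pdown => k nk; apply: IHN; lia.
Qed.

(* [D i j] is the matrix of the map from degree i to degree j, so that the n-th
   differential is [D n (n - 1)]; the indices are kept independent to avoid
   casts between [n + 1 - 1] and [n]. *)
Section ExactFrom.
Variables (R : comPzRingType) (K : fieldType) (phi : {rmorphism R -> K}).
Variables (rk : int -> nat) (D : forall i j : int, 'M[R]_(rk j, rk i)).
Hypothesis DD : forall i j k, D j k *m D i j = 0.
Variables (r : int -> int) (b : int).
Hypothesis r_rec : forall n, r n = (rk n)%:Z - r (n + 1).
Hypothesis r_gt : forall n, b < n -> r n = 0.

(** Exactness of the dual complex after localizing at the kernel of [phi], with the denominator [t]
    cleared. *)
Definition locally_exact (n : int) : Prop := forall x : 'rV_(rk n),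
  x *m D (n + 1) n = 0 ->
  exists t, phi t != 0 /\ exists y, t *: x = y *m D n (n - 1).

(** A lower bound is enough: as consecutive matrices compose to 0 and [rk n = r n + r (n + 1)],
    having it at [n] and [n + 1] forces equality. *)
Definition full_rank (n : int) : Prop :=
  r n <= (\rank (map_mx phi (D n (n - 1))))%:Z.

Definition minor_unit (n : int) : Prop :=
  exists2 x, minors (D n (n - 1)) (r n) x & phi x != 0.

Lemma full_rankS n :
  full_rank (n + 1) <-> r (n + 1) <= (\rank (map_mx phi (D (n + 1) n)))%:Z.
Proof. by rewrite /full_rank addrK. Qed.

(** The rank of [D (n + 1) n] is at most [rk n], hence so is [r (n + 1)]. *)
Lemma full_rank_ge0 n : full_rank (n + 1) -> 0 <= r n.
Proof.
move=> /full_rankS rn; rewrite r_rec subr_ge0; apply: le_trans rn _.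
by rewrite lez_nat rank_leq_row.
Qed.

(** The recursion for [r] is the size condition of [exact_splitting]. The variable [k] lets the
    lemma be used at [n + 1] with target degree [n], without a cast. *)
Lemma full_rank_splitting n k : k = n - 1 ->
    (forall m, n <= m -> full_rank m) ->
  exists (U : 'M_(`|r n|, rk k)) (V : 'M_(rk n, `|r n|)) d, phi d != 0 /\
    forall m (x : 'M_(m, rk n)), x *m D (n + 1) n = 0 ->
      d *: x = x *m (V *m U) *m D n k.
Proof.
move=> -> full.
have r0 : 0 <= r n by apply/full_rank_ge0/full; rewrite lerDl.
have r1 : 0 <= r (n + 1) by apply/full_rank_ge0/full; rewrite -addrA lerDl.
apply: (@exact_splitting _ _ phi _ _ _ _ `|r (n + 1)|).
- by apply/eqP; rewrite -eqz_nat PoszD !gez0_abs// r_rec subrK.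
- exact: DD.
- by rewrite -lez_nat gez0_abs//; exact: full.
- by rewrite -lez_nat gez0_abs//; apply/full_rankS/full; rewrite lerDl.
Qed.

Lemma locally_exact_full_rankP m : (forall n, m <= n -> locally_exact n) <->
  (forall n, m <= n -> full_rank n).
Proof.
split=> [exact_from|full n mn x xD].
  apply: (int_down_ind (b := b)) => [n bn _|n IHn mn].
    by rewrite /full_rank r_gt.
  have full k : n < k -> full_rank k.
    by move=> nk; apply: IHn => //; exact/ltW/(le_lt_trans mn).
  have [||U [V [d [d0 UV]]]] := @full_rank_splitting (n + 1) n.
  - by rewrite addrK.
  - by move=> k; rewrite lezD1; exact: full.
  have r1 : 0 <= r (n + 1).
    by apply/full_rank_ge0/full; rewrite -addrA ltrDl.
  rewrite /full_rank r_rec lerBlDr -[r (n + 1)]gez0_abs// -PoszD lez_nat.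
  rewrite addnC -leq_subLR.
  (* The rows of [B = D (n + 1) n] are killed by the next matrix, so the splitting in degree [n + 1]
     applies to [B] itself and gives [d B = B V U B]. *)
  apply: (exact_rank d0) (exact_from _ mn); apply: UV.
  exact: DD.
have [//||U [V [d [d0 UV]]]] := @full_rank_splitting n (n - 1).
  by move=> k nk; exact/full/(le_trans mn).
by exists d; split=> //; exists (x *m (V *m U)); exact: UV.
Qed.

(** For [r n = 0] both sides are trivial. For [r n > 0] the convention on the empty matrix cannot
    interfere: [rk n = 0] would give [r n = - r (n + 1) <= 0]. *)
Lemma full_rank_minorP n : 0 <= r n -> 0 <= r (n + 1) ->
  minor_unit n <-> full_rank n.
Proof.
move=> r0 r1; rewrite /minor_unit /full_rank /minors.
have [rn0|rn0] /= := leP (r n) 0.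
  split=> _; first exact: le_trans rn0 _.
  by exists 1 => //; rewrite rmorph1 oner_neq0.
case: ifP => [/andP[_ /eqP rk0]|_].
  have : r n <= 0 by rewrite r_rec rk0 sub0r oppr_le0.
  by rewrite leNgt rn0.
have -> : (r n <= (\rank (map_mx phi (D n (n - 1))))%:Z) =
    (`|r n| <= \rank (map_mx phi (D n (n - 1))))%N.
  by rewrite -{1}[r n]gez0_abs.
rewrite leq_rank_minorP; split=> [[x [g gi [h hi <-]] x0]|[g [h [gi hi x0]]]].
  by exists g, h; rewrite -map_mxsub det_map_mx.
exists (\det (mxsub g h (D n (n - 1)))); first by exists g => //; exists h.
by rewrite -det_map_mx map_mxsub.
Qed.

(** The degreewise equivalence requires [r n] and [r (n + 1)] to be nonnegative, which full rank in
    higher degrees provides; hence the downward induction. *)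
Lemma full_rank_minor_unitP m : (forall n, m <= n -> full_rank n) <->
  (forall n, m <= n -> minor_unit n).
Proof.
split=> [full n mn|unit].
  by apply/full_rank_minorP; [apply/full_rank_ge0/full|apply/full_rank_ge0/full|
    exact: full]; rewrite -?addrA; apply: le_trans mn _; rewrite lerDl.
apply: (int_down_ind (b := b)) => [n bn _|n IHn mn].
  by rewrite /full_rank r_gt.
have full k : n < k -> full_rank k.
  by move=> nk; apply: IHn => //; exact/ltW/(le_lt_trans mn).
apply/full_rank_minorP; last exact: unit.
  by apply/full_rank_ge0/full; rewrite ltrDl.
by apply/full_rank_ge0/full; rewrite -addrA ltrDl.
Qed.

End ExactFrom.

(** * Suprema and Krull dimension *)

Section ExtendedSup.
Implicit Types A : set (\bar int).

Lemma esupP A : supremums A (esup A).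
Proof.
rewrite /esup /supremum; case: ifPn => [/eqP ->|_]; last first.
  exact: xgetPex (supremums_bar_int A).
by split=> [x []|y _]; exact: leNye.
Qed.

Lemma esup_ge A x : A x -> (x <= esup A)%E.
Proof. by case: (esupP A) => + _; apply. Qed.

Lemma esup_le A y : (forall x, A x -> (x <= y)%E) -> (esup A <= y)%E.
Proof. by case: (esupP A) => _; apply. Qed.

Lemma oppe_einf_ge (S : set int) n : S n ->
  ((- n)%:E <= - einf [set k%:E | k in S])%E.
Proof.
by move=> Sn; rewrite oppeK; apply: esup_ge; exists n%:E => //; exists n.
Qed.

Lemma oppe_einf_le (S : set int) y : (forall n, S n -> ((- n)%:E <= y)%E) ->
  (- einf [set k%:E | k in S] <= y)%E.
Proof.
by move=> Sy; rewrite oppeK; apply: esup_le => _ [_ [n Sn <-] <-]; exact: Sy.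
Qed.

End ExtendedSup.

Section QuotientDimension.
Variables (R : comPzRingType) (I : ideal R).
Local Notation pi := (quot_map I).

Section Contraction.
Variable q : Spec (quot_ring I).

Fact contraction_ideal : ideal_axiom [set x | (q : set _) (pi x)].
Proof.
have [q0 qlin] := idealP q; split=> [|a u v] /=; first by rewrite rmorph0.
by rewrite rmorphD rmorphM; exact: qlin.
Qed.

Fact contraction_proper : ~ ideal_set (Ideal contraction_ideal) 1.
Proof. by rewrite /= rmorph1; exact: prime_proper. Qed.

Fact contraction_mul u v : ideal_set (Ideal contraction_ideal) (u * v) ->
  ideal_set (Ideal contraction_ideal) u \/ ideal_set (Ideal contraction_ideal) v.
Proof. by rewrite /= rmorphM; exact: prime_mul. Qed.

Definition contraction : Spec R :=
  PrimeIdeal contraction_proper contraction_mul.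

End Contraction.

Section Extension.
Variables (p : Spec R) (Ip : (I : set R) `<=` p).

Definition extension_set : set (quot_ring I) := [set pi x | x in (p : set R)].

(** Two lifts of one class differ by an element of [I], hence of [p]. *)
Lemma extension_setP x : extension_set (pi x) <-> (p : set R) x.
Proof.
split=> [[y py /quot_mapP/Ip]|px]; last by exists x.
by move=> /idealN; rewrite opprB => /idealD/(_ py); rewrite subrK.
Qed.

Fact extension_ideal : ideal_axiom extension_set.
Proof.
have [p0 plin] := idealP p; split; first by rewrite -(rmorph0 pi) extension_setP.
move=> a u v [x px <-] [y py <-]; have [c <-] := quot_map_surj a.
by rewrite -rmorphM -rmorphD extension_setP; exact: plin.
Qed.

Fact extension_proper : ~ ideal_set (Ideal extension_ideal) 1.
Proof. by rewrite /= -(rmorph1 pi) extension_setP; exact: prime_proper. Qed.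

Fact extension_mul u v : ideal_set (Ideal extension_ideal) (u * v) ->
  ideal_set (Ideal extension_ideal) u \/ ideal_set (Ideal extension_ideal) v.
Proof.
have [x <-] := quot_map_surj u; have [y <-] := quot_map_surj v.
by rewrite /= -rmorphM !extension_setP; exact: prime_mul.
Qed.

Definition extension : Spec (quot_ring I) :=
  PrimeIdeal extension_proper extension_mul.

End Extension.

Lemma quot_chainP l :
  (exists q : nat -> Spec (quot_ring I),
     forall i, (i < l)%N -> (q i : set _) `<` q i.+1) <->
  (exists p : nat -> Spec R, (I : set R) `<=` p 0%N /\
     forall i, (i < l)%N -> (p i : set R) `<` p i.+1).
Proof.
split=> [[q q_chain]|[p [Ip0 p_chain]]].
  exists (contraction \o q); split=> [x Ix|i /q_chain[qS qN]] /=.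
    by have -> : pi x = 0; [exact/quot_map_eq0|have [] := idealP (q 0%N)].
  split=> [x /qS//|qC]; apply: qN => z; have [x <-] := quot_map_surj z.
  exact: qC.
(* The sequence [p] is arbitrary beyond [l]; truncating the index makes every term contain [I], so
   that all of them extend to the quotient. *)
have Ip i : (I : set R) `<=` p (minn i l).
  elim: i => [|i IHi]; first by rewrite min0n.
  apply: subset_trans IHi _; have [il|] := boolP (i < l)%N.
    by rewrite (minn_idPl (ltnW il)) (minn_idPl il); case: (p_chain i il).
  by rewrite -leqNgt => li; rewrite (minn_idPr li) (minn_idPr (leqW li)).
exists (fun i => extension (@Ip i)) => i il.
have [] := p_chain i il; rewrite /= => pS pN; split.
  by move=> _ [x px <-]; apply/(extension_setP (@Ip _)); move: px;
    rewrite (minn_idPl (ltnW il)) (minn_idPl il); exact: pS.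
move=> pC; apply: pN => x px.
have /(_ (pi x)) := pC; rewrite !(extension_setP (@Ip _)).
by rewrite (minn_idPl (ltnW il)) (minn_idPl il); apply.
Qed.

(** Moving chains up to [R] makes quotients by different ideals comparable: a chain starting at
    [p 0] counts for every ideal inside [p 0]. *)
Lemma krull_dim_quotE : krull_dim (quot_ring I) =
  esup [set l%:Z%:E | l in [set l | exists p : nat -> Spec R,
    (I : set R) `<=` p 0%N /\ forall i, (i < l)%N -> (p i : set R) `<` p i.+1]].
Proof.
rewrite /krull_dim; congr (esup [set _ | l in _]).
by apply/seteqP; split=> l /quot_chainP.
Qed.

End QuotientDimension.

Lemma le_krull_dim_quot (R : comPzRingType) (I J : ideal R) :
  (I : set R) `<=` J -> (krull_dim (quot_ring J) <= krull_dim (quot_ring I))%E.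
Proof.
move=> IJ; rewrite !krull_dim_quotE; apply: esup_le => _ [l [p [Jp p_chain]] <-].
by apply: esup_ge; exists l => //; exists p; split=> //; exact: subset_trans Jp.
Qed.

(** * Alternating sums of ranks *)

Section AlternatingRank.
Variables (rk : int -> nat) (a b : int).
Hypothesis rk_bounded : forall n, ~~ (a <= n <= b) -> rk n = 0%N.

Lemma alternating_rank_gt n : b < n -> alternating_rank rk n = 0.
Proof.
move=> bn; apply: fsbig1 => i /= ni; rewrite rk_bounded ?mulr0//.
by apply/negP => /andP[_ ib]; move: (lt_le_trans bn ni); rewrite ltNge ib.
Qed.

(** Truncating at [b] makes the index set finite, so that the term at [n] can be split off. *)
Lemma alternating_rank_widen n : alternating_rank rk n =
  \sum_(i \in [set i : int | n <= i <= b]) (-1) ^+ `|i - n|%N * (rk i)%:Z.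
Proof.
apply/esym/fsbig_widen => i /= => [/andP[]//|[ni /negP nib]].
by rewrite rk_bounded ?mulr0//; apply: contra nib => /andP[_ ->]; rewrite ni.
Qed.

Lemma alternating_rankS n :
  alternating_rank rk n = (rk n)%:Z - alternating_rank rk (n + 1).
Proof.
have [bn|nb] := ltP b n.
  rewrite !alternating_rank_gt ?subr0 ?(lt_le_trans bn) ?lerDl// rk_bounded//.
  by rewrite negb_and -!ltNge bn orbT.
rewrite !alternating_rank_widen (fsbigD1 n)/= ?lexx//; last first.
  apply: sub_finite_set (finite_seq [seq n + k%:Z | k <- iota 0 `|b - n|.+1]).
  move=> i; rewrite /mkset => ib; apply/mapP; exists `|i - n|%N; last by lia.
  by rewrite mem_iota; lia.
rewrite subrr absz0 expr0 mul1r; congr (_ + _); rewrite -[RHS]mulN1r mulr_fsumr.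
have -> : [set i : int | n <= i <= b] `\ n = [set i : int | n + 1 <= i <= b].
  by apply/seteqP; split=> i /=; lia.
apply: eq_fsbigr => i /set_mem/= ni; rewrite mulrA -exprS; congr (_ ^+ _ * _).
lia.
Qed.

End AlternatingRank.

(** * Localized homology and coordinates *)

Section LocalizedHomology.
Variables (R : comPzRingType).

Lemma localization_neq0P (M : lmodType R) (p : Spec R) :
  (exists x : localization M p, x != 0) <->
  (exists m : M, forall t, ~ (p : set R) t -> t *: m <> 0).
Proof.
pose pi (x : fraction M p) : localization M p :=
  \pi_{eq_quot (@frac_equiv R M p)} x.
have eq0P m (s : denom p) : pi (m, s) = 0 <-> exists t : denom p, val t *: m = 0.
  rewrite -[0]/(pi (0, denom1 p)); split=> [/eqmodP/asboolP[t]|[t tm]].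
    by rewrite /= scale1r scaler0 subr0; exists t.
  by apply/eqmodP/asboolP; exists t; rewrite /= scale1r scaler0 subr0.
split=> [[x]|[m m_neq0]].
  rewrite -[x]reprK -/(pi _); case: (repr x) => m s /eqP ms0; exists m => t pt tm.
  have tP : t \notin (p : set R) by apply/negP => /set_mem.
  by apply/ms0/eq0P; exists (Sub t tP).
exists (pi (m, denom1 p)); apply/eqP => /eq0P[t]; apply: m_neq0 => /mem_set.
exact/negP/(valP t).
Qed.

Definition quot_module_map (M : lmodType R) (N : submodClosed M) (x : M) :
  quot_module N := \pi_{ideal_quot (submod_pred N)} x.

Lemma quot_module_mapP (M : lmodType R) (N : submodClosed M) (x y : M) :
  quot_module_map N x = quot_module_map N y <-> x - y \in N.
Proof.
rewrite -[_ \in _]/(x - y \in submod_pred N) Quotient.idealrBE.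
by split=> /eqP.
Qed.

Lemma quot_module_map_eq0 (M : lmodType R) (N : submodClosed M) (x : M) :
  quot_module_map N x = 0 <-> x \in N.
Proof.
have <- : quot_module_map N 0 = 0 by rewrite /quot_module_map raddf0.
by rewrite quot_module_mapP subr0.
Qed.

Lemma quot_module_mapZ (M : lmodType R) (N : submodClosed M) t (x : M) :
  t *: quot_module_map N x = quot_module_map N (t *: x).
Proof.
apply/quot_module_mapP; rewrite -scalerBr; apply: rpredZ.
exact/quot_module_mapP/reprK.
Qed.

(** With [P] the complement of [p], the left side is the criterion of [localization_neq0P]. *)
Lemma homology_neq0P (X : complex R) (n : int) (P : R -> Prop) :
  (exists h : homology X n, forall t, P t -> t *: h <> 0) <->
  (exists z : X n, diff X n (n - 1) z = 0 /\
     forall t, P t -> ~ exists y, diff X (n + 1) n y = t *: z).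
Proof.
split=> [[h h_neq0]|[z [zZ z_neq0]]].
  exists (val (repr h)); split; first exact/eqP/(cycleP (repr h)).
  move=> t Pt yE; apply: (h_neq0 t Pt); rewrite -[h]reprK.
  rewrite -[\pi _]/(quot_module_map _ _) quot_module_mapZ.
  exact/quot_module_map_eq0/asboolP.
have zP : z \in @cycle_pred R X n by apply/eqP.
exists (quot_module_map _ (Cycle zP)) => t Pt.
by rewrite quot_module_mapZ => /quot_module_map_eq0/asboolP; exact: z_neq0.
Qed.

End LocalizedHomology.

Section Coordinates.
Variable R : comPzRingType.

Lemma is_basis_inj (M : lmodType R) r (e : 'I_r -> M) : is_basis e ->
  forall c c' : 'I_r -> R, \sum_i c i *: e i = \sum_i c' i *: e i -> c =1 c'.
Proof.
move=> e_basis c c' cc' i; have [d [_ d_uniq]] := e_basis (\sum_i c i *: e i).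
by rewrite -(d_uniq c erefl) -(d_uniq c' cc').
Qed.

Lemma represents_exists (M N : lmodType R) r s (e : 'I_r -> M) (e' : 'I_s -> N)
    (f : M -> N) : is_basis e' -> exists A, represents e e' f A.
Proof.
move=> e'_basis.
have /choice[c cE] : forall j, exists c, f (e j) = \sum_i c i *: e' i.
  by move=> j; have [c [cE _]] := e'_basis (f (e j)); exists c.
exists (\matrix_(i, j) c j i) => j; rewrite cE.
by apply: eq_bigr => i _; rewrite mxE.
Qed.

Lemma represents_uniq (M N : lmodType R) r s (e : 'I_r -> M) (e' : 'I_s -> N)
    (f : M -> N) A B : is_basis e' ->
  represents e e' f A -> represents e e' f B -> A = B.
Proof.
move=> e'_basis fA fB; apply/matrixP => i j.
by apply: (is_basis_inj e'_basis (c := A^~ j) (c' := B^~ j)); rewrite -fA -fB.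
Qed.

Lemma represents_comp (M N L : lmodType R) r s t (e : 'I_r -> M)
    (e' : 'I_s -> N) (e'' : 'I_t -> L) (f : M -> N) (g : {linear N -> L}) A B :
  represents e e' f A -> represents e' e'' g B ->
  represents e e'' (g \o f) (B *m A).
Proof.
move=> fA gB j; rewrite /= fA linear_sum.
under [LHS]eq_bigr do rewrite linearZ_LR gB scaler_sumr.
rewrite exchange_big; apply: eq_bigr => i _; rewrite mxE scaler_suml.
by apply: eq_bigr => k _; rewrite scalerA mulrC.
Qed.

Lemma represents0 (M N : lmodType R) r s (e : 'I_r -> M) (e' : 'I_s -> N)
    (f : M -> N) : f =1 \0 -> represents e e' f 0.
Proof.
by move=> f0 j; rewrite f0 big1// => i _; rewrite mxE scale0r.
Qed.

(** Coordinates in the dual basis, as a row so that precomposition becomes right multiplication. *)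
Definition hom_row (M : lmodType R) r (e : 'I_r -> M) (h : M -> R^o) : 'rV[R]_r :=
  \row_j h (e j).

Lemma hom_row_comp (M N : lmodType R) r s (e : 'I_r -> M) (e' : 'I_s -> N)
    (f : M -> N) A (h : {linear N -> R^o}) : represents e e' f A ->
  hom_row e (h \o f) = hom_row e' h *m A.
Proof.
move=> fA; apply/rowP => j; rewrite !mxE /= fA linear_sum.
by apply: eq_bigr => i _; rewrite linearZ_LR !mxE mulrC.
Qed.

Lemma hom_row_inj (M : lmodType R) r (e : 'I_r -> M) (h k : hom_module M R^o) :
  is_basis e -> hom_row e h = hom_row e k -> h = k.
Proof.
move=> e_basis /rowP hk; apply: val_inj; apply/funext => x.
have [c [-> _]] := e_basis x; rewrite /= !linear_sum; apply: eq_bigr => i _.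
by rewrite !linearZ_LR; congr (_ *: _); have := hk i; rewrite !mxE.
Qed.

Lemma hom_row_surj (M : lmodType R) r (e : 'I_r -> M) (v : 'rV[R]_r) :
  is_basis e -> exists h : hom_module M R^o, hom_row e h = v.
Proof.
move=> e_basis.
have /choice[c cE] : forall x, exists c : 'I_r -> R, x = \sum_i c i *: e i.
  by move=> x; have [c [xE _]] := e_basis x; exists c.
pose h (x : M) : R^o := \sum_i c x i * v 0 i.
have h_lin : h \in @linear_fun R M R^o.
  apply/asboolP => a x y; rewrite /h scaler_sumr -big_split; apply: eq_bigr => i _.
  (* The coordinates are chosen separately for each vector; their uniqueness makes them linear. *)
  have -> : c (a *: x + y) i = a * c x i + c y i.
    apply: (is_basis_inj e_basis (c' := fun i => a * c x i + c y i)).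
    rewrite -cE {1}(cE x) {1}(cE y) scaler_sumr -big_split; apply: eq_bigr => k _.
    by rewrite scalerA scalerDl.
  by rewrite mulrDl -mulrA.
exists (Defs.Hom h_lin); apply/rowP => j; rewrite mxE /= /h (bigD1 j)//=.
have cj i : c (e j) i = (i == j)%:R.
  apply: (is_basis_inj e_basis (c' := fun i => (i == j)%:R)).
  rewrite -cE (bigD1 j)//= eqxx scale1r big1 ?addr0// => k /negPf ->.
  by rewrite scale0r.
by rewrite cj eqxx mul1r big1 ?addr0// => i /negPf ij; rewrite cj ij mul0r.
Qed.

End Coordinates.

(** * Homology of the dual complex in coordinates *)

Section DualHomology.
Variables (R : comPzRingType) (F : complex R) (rk : int -> nat).
Variables (e : forall n : int, 'I_(rk n) -> F n).
Hypothesis e_basis : forall n, is_basis (@e n).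
Variables (D : forall i j : int, 'M[R]_(rk j, rk i)).
Hypothesis D_diff : forall i j, represents (@e i) (@e j) (diff F i j) (D i j).
Variables (p : Spec R).

Lemma dual_diff_row m n (h : dual F m) :
  hom_row (@e (- n)) (diff (dual F) m n h) = hom_row (@e (- m)) h *m D (- n) (- m).
Proof. exact: hom_row_comp. Qed.

(** Under [hom_row], cycles become rows killed by one matrix and boundaries become row multiples of
    the next. Dualizing turns degree [m] into [- m]. *)
Lemma dual_homology_neq0P m :
  (exists x : localization (homology (dual F) m) p, x != 0) <->
  ~ locally_exact (residue_map p) D (- m).
Proof.
rewrite localization_neq0P homology_neq0P /locally_exact.
have -> : - m + 1 = - (m - 1) by rewrite opprB addrC.
have -> : - m - 1 = - (m + 1) by rewrite opprD.
split=> [[z [zZ z_neq0]] ex|nex].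
  have [|t [/eqP t0 [y yE]]] := ex (hom_row (@e (- m)) z).
    by rewrite -dual_diff_row zZ; apply/rowP => j; rewrite !mxE.
  have [h hE] := hom_row_surj y (@e_basis (- (m + 1))).
  apply: (z_neq0 t); first by move=> /residue_map_eq0/eqP.
  exists h; apply: (hom_row_inj (@e_basis (- m))).
  rewrite (@dual_diff_row (m + 1) m) hE -yE.
  by apply/rowP => j; rewrite !mxE.
apply: contrapT => nz; apply: nex => x xD.
have [z zE] := hom_row_surj x (@e_basis (- m)).
apply: contrapT => nt; apply: nz; exists z; split.
  apply: (hom_row_inj (@e_basis (- (m - 1)))).
  by rewrite (@dual_diff_row m (m - 1)) zE xD; apply/rowP => j; rewrite !mxE.
move=> t pt [y yE]; apply: nt; exists t; split.
  by apply/negP => /residue_map_eq0.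
exists (hom_row (@e (- (m + 1))) y).
rewrite -(@dual_diff_row (m + 1) m) yE -zE.
by apply/rowP => j; rewrite !mxE.
Qed.

End DualHomology.

(** * Minor ideals inside primes and the dimension formula *)

Lemma ideal_gen_subset (R : comPzRingType) (S : set R) (J : ideal R) :
  (ideal_gen S : set R) `<=` J <-> S `<=` J.
Proof.
split=> [IJ x Sx|SJ x]; first by apply: IJ => I [_]; exact.
by move=> /(_ J); apply; split=> //; exact: idealP.
Qed.

Lemma minor_ideal_primeP (R : comPzRingType) (rk : int -> nat)
    (D : forall i j : int, 'M[R]_(rk j, rk i)) (r : int -> int) n (p : Spec R) :
  (minor_ideal (D n (n - 1)) (r n) : set R) `<=` p <->
  ~ minor_unit (residue_map p) D r n.
Proof.
rewrite ideal_gen_subset; split=> [Sp [x /Sp px /negP[]]|nu x Sx].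
  exact/residue_map_eq0.
apply/residue_map_eq0; apply/negP => /negP x0; apply: nu.
by exists x.
Qed.

Theorem corollary2 (R : comPzRingType) (R_noeth : noetherian R)
    (F : complex R) (a b : int) (rk : int -> nat)
    (e : forall n : int, 'I_(rk n) -> F n)
    (e_basis : forall n : int, is_basis (e n))
    (rk_bounded : forall n : int, ~~ (a <= n <= b) -> rk n = 0%N)
    (A : forall n : int, 'M[R]_(rk (n - 1), rk n))
    (A_diff : forall n : int,
      represents (e n) (e (n - 1)) (diff F n (n - 1)) (A n)) :
  dim_complex (dual F) =
  esup [set (krull_dim (quot_ring (minor_ideal (A n) (alternating_rank rk n)))
             + n%:E)%E | n in [set: int]].
Proof.
(* The family [A] covers only the pairs [(n, n - 1)]; it is extended to all pairs of degrees, and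
   uniqueness of coordinates identifies the two. *)
pose D i j : 'M[R]_(rk j, rk i) :=
  projT1 (cid (represents_exists (e i) (diff F i j) (e_basis j))).
have D_diff i j : represents (e i) (e j) (diff F i j) (D i j).
  exact: projT2 (cid (represents_exists _ _ _)).
have AD n : A n = D n (n - 1).
  exact: represents_uniq (e_basis _) (A_diff n) (D_diff _ _).
have DD i j k : D j k *m D i j = 0.
  apply: (represents_uniq (e_basis k) (represents_comp (D_diff i j) (D_diff j k))).
  by apply: represents0 => x; exact: diff_diff.
pose r := alternating_rank rk.
have r_rec : forall n, r n = (rk n)%:Z - r (n + 1) := alternating_rankS rk_bounded.
have r_gt n : b < n -> r n = 0 by exact: (alternating_rank_gt rk_bounded).
pose exact_at p := locally_exact (residue_map p) D.
have exactP p m : (forall n, m <= n -> exact_at p n) <->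
    (forall n, m <= n -> minor_unit (residue_map p) D r n).
  rewrite (locally_exact_full_rankP _ DD r_rec r_gt).
  exact: full_rank_minor_unitP r_rec r_gt _.
pose I n := minor_ideal (A n) (alternating_rank rk n).
have IP n (p : Spec R) : (I n : set R) `<=` p <->
    ~ minor_unit (residue_map p) D r n.
  by rewrite /I AD minor_ideal_primeP.
(* Exactness may fail strictly above [n]; this only increases the contribution of [p]. *)
have I_nexact n (p : Spec R) : (I n : set R) `<=` p ->
    exists2 m, n <= m & ~ exact_at p m.
  move=> /IP nu; apply: contrapT => ex; apply: nu.
  apply: (exactP p n).1 => // m nm; apply: contrapT => nex; apply: ex.
  by exists m.
have last_nexact n p : ~ exact_at p n ->
    exists2 m, ~ exact_at p m & forall k, m < k -> exact_at p k.
  move: n; apply: (int_down_ind (b := b)) => [n bn []|n IHn nexn].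
    apply: (locally_exact_full_rankP _ DD r_rec r_gt n).2 => // k nk.
    by rewrite /full_rank r_gt// (lt_le_trans bn).
  have [[k [nk nexk]]|nex] := pselect (exists k, n < k /\ ~ exact_at p k).
    exact: IHn nexk.
  exists n => // k nk; apply: contrapT => nexk; apply: nex; by exists k.
(* Above the last failure [m] all minor ideals escape [p]. If [I m] did too, exactness would reach
   down to [m]. *)
have nexact_I m p : ~ exact_at p m -> (forall k, m < k -> exact_at p k) ->
    (I m : set R) `<=` p.
  move=> nexm ex; apply/IP => um; apply: nexm.
  apply: (exactP p m).2 => // k; rewrite le_eqVlt => /predU1P[<-//|mk].
  by apply: (exactP p k).1 => // l kl; apply: ex; exact: lt_le_trans kl.
apply/le_anti/andP; split; apply: esup_le.
  move=> _ [p _ <-]; have [[n nex]|ex] := pselect (exists n, ~ exact_at p n).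
    have [m nexm exm] := last_nexact n p nex.
    apply: le_trans (esup_ge _); last by exists m.
    apply: leeD; first exact/le_krull_dim_quot/nexact_I.
    apply: oppe_einf_le => k /(dual_homology_neq0P e_basis D_diff) nexk.
    by rewrite lee_fin leNgt; apply/negP => /exm.
  (* Outside the support the infimum is [+oo], so [p] contributes [-oo]. *)
  have : (- inf_homology (dual F) p <= -oo)%E.
    apply: oppe_einf_le => k /(dual_homology_neq0P e_basis D_diff) nexk.
    by case: ex; exists (- k).
  by rewrite leeNy_eq => /eqP ->; rewrite addeNy leNye.
(* The finite [n] is moved across, so that the bound can be checked on one chain at a time; the
   chain's first prime serves as [p] on the left side. *)
move=> _ [n _ <-]; rewrite -leeBrDr// krull_dim_quotE; apply: esup_le.
move=> _ [l [p [Ip p_chain]] <-]; rewrite leeBrDr//.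
have [m nm nexm] := I_nexact _ _ Ip.
apply: le_trans (esup_ge _); last by exists (p 0%N).
apply: leeD.
  by rewrite krull_dim_quotE; apply: esup_ge; exists l => //; exists p; split.
apply: le_trans (_ : (m%:E <= _)%E); first by rewrite lee_fin.
rewrite -[m]opprK; apply: oppe_einf_ge.
by apply/(dual_homology_neq0P e_basis D_diff); rewrite opprK.
Qed.
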